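(* Let $A\in\mathbb{R}^{p\times n}$ and $B\in\mathbb{R}^{p\times m}$ satisfy $\operatorname{rge} B\subset \operatorname{rge} A$, let $$\mathcal{D}(A,B)=\left\{\left(Y,-\tfrac12 YY^T\right)\in\mathbb{R}^{n\times m}\times\mathbb{S}^n \;\middle|\; Y\in\mathbb{R}^{n\times m},\ AY=B\right\},$$ and let $\sigma_{\mathcal{D}(A,B)}$ be its support function. Then for all $(X,V)\in\operatorname{dom}\sigma_{\mathcal{D}(A,B)}$, $$\partial\sigma_{\mathcal{D}(A,B)}(X,V)=\left\{(Y,W)\in\Omega(A,B)\;\middle|\; \exists Z\in\mathbb{R}^{p\times m}:\ X=VY+A^TZ,\ \ \left\langle V,\tfrac12 YY^T+W\right\rangle=0\right\},$$ where $$\Omega(A,B)=\left\{(Y,W)\in\mathbb{R}^{n\times m}\times\mathbb{S}^n \;\middle|\; AY=B\ \text{ and }\ \tfrac12 YY^T+W\in\mathcal{K}_A^\circ\right\}.$$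
   Context: $\mathbb{S}^n$ is the space of real symmetric $n\times n$ matrices with inner product $\langle V,W\rangle=\mathrm{tr}(VW)$, and $\mathbb{R}^{n\times m}\times\mathbb{S}^n$ carries the inner product $\langle (Y,W),(X,V)\rangle=\mathrm{tr}(Y^TX)+\mathrm{tr}(WV)$. $\operatorname{rge}$ denotes the range (column space). $\mathcal{K}_A:=\{V\in\mathbb{S}^n \mid u^TVu\ge 0\ \text{for all } u\in\ker A\}$ and $\mathcal{K}_A^\circ:=\{W\in\mathbb{S}^n\mid \langle W,V\rangle\le 0\ \text{for all } V\in\mathcal{K}_A\}$ is its polar cone. The support function of a nonempty set $S$ is $\sigma_S(x)=\sup_{v\in S}\langle v,x\rangle\in\mathbb{R}\cup\{+\infty\}$. For $f$ with values in $\mathbb{R}\cup\{+\infty\}$, $\operatorname{dom} f=\{x\mid f(x)<+\infty\}$, and for convex $f$ and $\bar x\in\operatorname{dom} f$, $\partial f(\bar x)=\{v\mid f(x)\ge f(\bar x)+\langle v,x-\bar x\rangle\ \text{for all } x\}$. It is known from earlier work that $$\operatorname{dom}\sigma_{\mathcal{D}(A,B)}=\left\{(X,V)\in\mathbb{R}^{n\times m}\times\mathbb{S}^n\;\middle|\;\operatorname{rge}\begin{pmatrix} X \\ B \end{pmatrix}\subset\operatorname{rge} M(V),\ V\in\mathcal{K}_A\right\},\qquad M(V)=\begin{pmatrix} V & A^T \\ A & 0 \end{pmatrix}.$$ *)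

(* Defs.v *)
From HB Require Import structures.
From mathcomp Require Import all_boot all_order all_algebra.
From mathcomp Require Import all_classical all_reals ereal.

Set Implicit Arguments.
Unset Strict Implicit.
Unset Printing Implicit Defensive.

Import Order.TTheory GRing.Theory Num.Theory.

Local Open Scope classical_set_scope.
Local Open Scope ring_scope.

(* S^n, as a set of matrices. *)
Definition symmx (R : realType) (n : nat) : set 'M[R]_n := [set V | V^T = V].
Arguments symmx R n : clear implicits.

(* R^(n x m) x S^n. It is a subset of the type 'M[R]_(n, m) * 'M[R]_n, so
   every notion below that depends on the ambient space (polar cone, domain,
   subdifferential) is relativized to symmetric second components. *)
Definition ambient (R : realType) (n m : nat) : set ('M[R]_(n, m) * 'M[R]_n) :=
  [set x | symmx R n x.2].
Arguments ambient R n m : clear implicits.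

Definition sym_inner (R : realType) (n : nat) (V W : 'M[R]_n) : R :=
  \tr (V *m W).

Definition space_inner (R : realType) (n m : nat)
    (v x : 'M[R]_(n, m) * 'M[R]_n) : R :=
  \tr (v.1^T *m x.1) + sym_inner v.2 x.2.

(* The column space; the matrix inclusion (_ <= _)%MS compares row spaces. *)
Definition rgeset (R : realType) (p q : nat) (M : 'M[R]_(p, q)) : set 'cV[R]_p :=
  range (fun u : 'cV[R]_q => M *m u).

Definition kerset (R : realType) (p q : nat) (M : 'M[R]_(p, q)) : set 'cV[R]_q :=
  [set u | M *m u = 0].

Definition coneK (R : realType) (p n : nat) (A : 'M[R]_(p, n)) : set 'M[R]_n :=
  [set V | symmx R n V /\
    forall u : 'cV[R]_n, kerset A u -> 0 <= (u^T *m V *m u) ord0 ord0].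

Definition polar_cone (R : realType) (n : nat) (K : set 'M[R]_n) : set 'M[R]_n :=
  [set W | symmx R n W /\ forall V, K V -> sym_inner W V <= 0].

Definition support_fun (R : realType) (n m : nat)
    (S : set ('M[R]_(n, m) * 'M[R]_n)) (x : 'M[R]_(n, m) * 'M[R]_n) : \bar R :=
  ereal_sup [set (space_inner v x)%:E | v in S].

Definition effdom (R : realType) (n m : nat)
    (f : 'M[R]_(n, m) * 'M[R]_n -> \bar R) : set ('M[R]_(n, m) * 'M[R]_n) :=
  [set x | ambient R n m x /\ (f x < +oo)%E].

(* Meaningful at points xbar of effdom f. *)
Definition subdiff (R : realType) (n m : nat)
    (f : 'M[R]_(n, m) * 'M[R]_n -> \bar R) (xbar : 'M[R]_(n, m) * 'M[R]_n) :
    set ('M[R]_(n, m) * 'M[R]_n) :=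
  [set v | ambient R n m v /\
    forall x, ambient R n m x -> (f xbar + (space_inner v (x - xbar))%:E <= f x)%E].

Definition setD_AB (R : realType) (p n m : nat)
    (A : 'M[R]_(p, n)) (B : 'M[R]_(p, m)) : set ('M[R]_(n, m) * 'M[R]_n) :=
  [set (Y, - (2^-1 *: (Y *m Y^T))) | Y in [set Y : 'M[R]_(n, m) | A *m Y = B]].

Definition Omega (R : realType) (p n m : nat)
    (A : 'M[R]_(p, n)) (B : 'M[R]_(p, m)) : set ('M[R]_(n, m) * 'M[R]_n) :=
  [set P | ambient R n m P /\ A *m P.1 = B /\
    polar_cone (coneK A) (2^-1 *: (P.1 *m P.1^T) + P.2)].

(* Main.v *)
Require Import Defs.
From mathcomp Require Import all_boot all_order all_algebra.
From mathcomp Require Import all_classical all_reals ereal.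
From mathcomp Require Import ring lra.

(** A subgradient of a support function at [xbar] is a point dominated by the
    support function everywhere and equal to it at [xbar].  Along [Y + t D] with
    [A D = 0], the pairing of [(Y, -YY^T/2)] with [(X, V)] is quadratic in [t],
    with slope [tr (D^T (X - V Y))] and curvature [- tr (D^T V D)].  Hence
    finiteness forces [V] into [coneK A]; for such [V], the supremum is attained
    at [Y] exactly when the slope vanishes on all such [D], i.e. when the columns
    of [X - V Y] lie in the range of [A^T].  Domination is tested at the
    points [(A^T Z, 0)] and [(V' Y, V')] with [V'] in [coneK A]. *)

Set Implicit Arguments.
Unset Strict Implicit.
Unset Printing Implicit Defensive.

Import Order.TTheory GRing.Theory Num.Theory.

Local Open Scope classical_set_scope.
Local Open Scope ring_scope.

(** * Real quadratics under one-sided bounds *)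

Section RealQuadratics.
Context {R : realType}.
Implicit Types a b c M : R.

Lemma quadratic_domination_slope0 a b : (forall t, t * a <= t ^+ 2 * b) -> a = 0.
Proof.
move=> dom; set c := `|b| + 1.
(* The test point is [t = a / (2 * c)]: there [t * a] equals [2 * c * t ^+ 2], while the right side
   is at most [c * t ^+ 2], so [t] vanishes. *)
have c_gt0 : 0 < c by rewrite ltr_wpDl.
have le_bc : b <= c by rewrite (le_trans (ler_norm b)) // lerDl.
have := dom (a / (2 * c)).
have -> : a / (2 * c) * a = (2 * c) * (a / (2 * c)) ^+ 2.
  by field; rewrite gt_eqF.
move=> le2.
have t0 : (a / (2 * c)) ^+ 2 <= 0.
  have := sqr_ge0 (a / (2 * c)); set s := _ ^+ 2 in le2 * => s_ge0.
  by nra.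
have : (a / (2 * c)) ^+ 2 == 0 by rewrite eq_le t0 sqr_ge0.
rewrite sqrf_eq0 mulf_eq0 invr_eq0 mulf_eq0 pnatr_eq0 /= (gt_eqF c_gt0) orbF.
by move/eqP.
Qed.

Lemma quadratic_bounded_curvature a b c M :
  (forall t, c + t * a - t ^+ 2 * b <= M) -> 0 <= b.
Proof.
move=> bnd; rewrite leNgt; apply/negP => b_lt0.
(* Adding the bounds at [t] and [- t] cancels the slope. This [t] is at least 1 and makes [t * - b],
   hence also [t ^+ 2 * - b], exceed [M - c]. *)
set t := 1 + `|M - c| / - b.
have nb_gt0 : 0 < - b by rewrite oppr_gt0.
have q_ge0 : 0 <= `|M - c| / - b by rewrite divr_ge0 // ltW.
have tb : t * - b = - b + `|M - c| by rewrite /t mulrDl mul1r divfK ?gt_eqF.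
have t_ge1 : 1 <= t by rewrite lerDl.
have : t * - b <= t * (t * - b) by rewrite ler_peMl // tb addr_ge0 // ltW.
have := bnd t; have := bnd (- t); have := ler_norm (M - c).
by lra.
Qed.

End RealQuadratics.

(** * Subgradients of an arbitrary support function *)

Section SupportFunction.
Context {R : realType} {n m : nat}.
Implicit Types (S : set ('M[R]_(n, m) * 'M[R]_n)) (v x y : 'M[R]_(n, m) * 'M[R]_n).

Lemma space_innerDr v x y : space_inner v (x + y) = space_inner v x + space_inner v y.
Proof. by rewrite /space_inner /sym_inner /= !mulmxDr !mxtraceD; ring. Qed.

Lemma space_innerNr v x : space_inner v (- x) = - space_inner v x.
Proof. by rewrite /space_inner /sym_inner /= !mulmxN !raddfN /= opprD. Qed.

Lemma space_inner0r v : space_inner v 0 = 0.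
Proof. by rewrite /space_inner /sym_inner /= !mulmx0 !mxtrace0 addr0. Qed.

Lemma ambientD x y : ambient R n m x -> ambient R n m y -> ambient R n m (x + y).
Proof. by rewrite /ambient /symmx /= => xs ys; rewrite raddfD /= xs ys. Qed.

Lemma ambient0 : ambient R n m 0.
Proof. by rewrite /ambient /symmx /= trmx0. Qed.

Lemma le_support_fun S v x : S v -> ((space_inner v x)%:E <= support_fun S x)%E.
Proof. by move=> Sv; apply: ereal_sup_ubound; exists v. Qed.

Lemma support_fun_leP S x (e : \bar R) :
  (support_fun S x <= e)%E <-> forall v, S v -> ((space_inner v x)%:E <= e)%E.
Proof.
split=> [le_e v Sv|le_e]; first exact: le_trans (le_support_fun _ Sv) le_e.
by apply: ge_ereal_sup => _ [v Sv <-]; exact: le_e.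
Qed.

Lemma support_fun_fin_num S x : S !=set0 -> (support_fun S x < +oo)%E ->
  support_fun S x \is a fin_num.
Proof.
move=> [v Sv] lt_oo; rewrite fin_numE -ltey lt_oo andbT gt_eqF //.
exact: lt_le_trans (ltNyr _) (le_support_fun x Sv).
Qed.

(** Testing the subgradient inequality at [x + y] and using subadditivity gives domination, after
    the finite value at [x] is cancelled. Testing it at 0, where the support function is at most 0,
    gives the missing inequality at [x]. *)
Lemma subdiff_support_fun S x v : S !=set0 -> effdom (support_fun S) x ->
  subdiff (support_fun S) x v <->
  [/\ ambient R n m v,
      forall y, ambient R n m y -> ((space_inner v y)%:E <= support_fun S y)%E
    & support_fun S x = (space_inner v x)%:E].
Proof.
move=> S0 [x_amb x_fin].
have fin := support_fun_fin_num S0 x_fin.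
split=> [[v_amb sub]|[v_amb dom eq_x]]; last first.
  split=> // y y_amb; rewrite eq_x -EFinD space_innerDr space_innerNr addrC subrK.
  exact: dom.
have dom y : ambient R n m y -> ((space_inner v y)%:E <= support_fun S y)%E.
  move=> y_amb; have := sub _ (ambientD x_amb y_amb).
  rewrite (addrC x y) addrK => le_xy.
  have : (support_fun S (y + x)%R <= support_fun S x + support_fun S y)%E.
    apply/support_fun_leP => w Sw; rewrite space_innerDr addrC EFinD.
    exact: leeD (le_support_fun _ Sw) (le_support_fun _ Sw).
  by move/(le_trans le_xy); rewrite leeD2lE.
split=> //; apply/le_anti; rewrite dom // andbT.
have le0 : (support_fun S 0%R <= 0)%E.
  by apply/support_fun_leP => w _; rewrite space_inner0r.
have := le_trans (sub _ ambient0) le0.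
by rewrite sub0r space_innerNr EFinN sube_le0.
Qed.

End SupportFunction.

(** * Orthogonality and positivity for the trace form *)

Section TraceForm.
Context {R : realType}.

Lemma trace_form_eq0 n m (E : 'M[R]_(n, m)) :
  (forall C : 'M[R]_(n, m), \tr (C^T *m E) = 0) -> E = 0.
Proof.
move=> tr0; apply/matrixP => i j; rewrite mxE -[RHS](tr0 (delta_mx i j)).
rewrite trmx_delta -(mul_delta_mx (0 : 'I_1)) -mulmxA mxtrace_mulC.
by rewrite trace_mx11 -rowE -colE !mxE.
Qed.

(** The orthogonal complement of the kernel of [A] is the range of [A^T]. Directions
    [cokermx A *m C] suffice as tests, since [A] kills [cokermx A]. *)
Lemma kernel_orthogonal_factor p n m (A : 'M[R]_(p, n)) (E : 'M[R]_(n, m)) :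
  (forall D : 'M[R]_(n, m), A *m D = 0 -> \tr (D^T *m E) = 0) ->
  exists Z : 'M[R]_(p, m), E = A^T *m Z.
Proof.
move=> orth; suff /submxP[Z EZ] : (E^T <= A)%MS.
  by exists Z^T; rewrite -trmx_mul -EZ trmxK.
rewrite submxE -[E^T *m _]trmxK trmx_mul trmxK trmx_eq0; apply/eqP.
apply: trace_form_eq0 => C; rewrite mulmxA -trmx_mul; apply: orth.
by rewrite mulmxA mulmx_coker mul0mx.
Qed.

Lemma rgeset_sub_factor p n m (A : 'M[R]_(p, n)) (B : 'M[R]_(p, m)) :
  rgeset B `<=` rgeset A -> exists Y : 'M[R]_(n, m), A *m Y = B.
Proof.
move=> rgeBA.
have /choice[f fP] : forall j, exists u : 'cV[R]_n, A *m u = col j B.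
  move=> j; have [|u _ Au] := rgeBA (col j B); last by exists u.
  by exists (delta_mx j 0) => //; rewrite -colE.
exists (\matrix_(i, j) f j i 0); apply/matrixP => i j.
have /matrixP/(_ i 0) := fP j; rewrite !mxE => <-.
by apply: eq_bigr => k _; rewrite mxE.
Qed.

(** The trace sums the quadratic form of [V] over the columns of [D], all of which lie in the kernel
    of [A]. *)
Lemma coneK_trace_ge0 p n m (A : 'M[R]_(p, n)) (V : 'M[R]_n) (D : 'M[R]_(n, m)) :
  coneK A V -> A *m D = 0 -> 0 <= \tr (D^T *m V *m D).
Proof.
move=> [_ V_ge0] AD0; apply: sumr_ge0 => j _.
have := V_ge0 (col j D); rewrite /kerset /= {1}colE mulmxA AD0 mul0mx => /(_ erefl).
by rewrite tr_col -!row_mul colE mulmxA -colE !mxE.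
Qed.

End TraceForm.

(** * The support function of [setD_AB A B] *)

Section SupportD.
Context {R : realType} {p n m : nat}.
Variables (A : 'M[R]_(p, n)) (B : 'M[R]_(p, m)).
Implicit Types (X Y D : 'M[R]_(n, m)) (V : 'M[R]_n).

Definition graph_pt (Y : 'M[R]_(n, m)) : 'M[R]_(n, m) * 'M[R]_n :=
  (Y, - (2^-1 *: (Y *m Y^T))).

Lemma setD_AB_graph_pt Y : A *m Y = B -> setD_AB A B (graph_pt Y).
Proof. by exists Y. Qed.

(** Isolates the term whose sign encodes polarity and whose vanishing is the complementarity
    condition. *)
Lemma space_inner_graph_ptE Y W X V :
  space_inner (Y, W) (X, V) =
  space_inner (graph_pt Y) (X, V) + sym_inner V (2^-1 *: (Y *m Y^T) + W).
Proof.
rewrite /space_inner /sym_inner /= mulmxDr mxtraceD mulNmx raddfN /=.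
by rewrite (mxtrace_mulC W) (mxtrace_mulC (_ *: _) V); ring.
Qed.

Lemma space_inner_graph_ptD Y D X V t : symmx R n V ->
  space_inner (graph_pt (Y + t *: D)) (X, V) =
  space_inner (graph_pt Y) (X, V) + t * \tr (D^T *m (X - V *m Y))
    - t ^+ 2 * (2^-1 * \tr (D^T *m V *m D)).
Proof.
move=> Vs.
have quad Y1 Y2 : \tr (Y1 *m Y2^T *m V) = \tr (Y2^T *m V *m Y1).
  by rewrite -mulmxA mxtrace_mulC.
(* Symmetry of [V] merges the two cross terms, which absorbs the factor 1/2 in the slope. *)
have sym Y1 Y2 : \tr (Y1^T *m V *m Y2) = \tr (Y2^T *m V *m Y1).
  by rewrite -mxtrace_tr !trmx_mul trmxK Vs mulmxA.
rewrite /space_inner /sym_inner /= !mulNmx !raddfN /= -!scalemxAl !mxtraceZ !quad.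
have -> : (Y + t *: D)^T = Y^T + t *: D^T by rewrite raddfD /= linearZ.
rewrite !(mulmxDl, mulmxDr) mulmxN -!(scalemxAl, scalemxAr) !(mxtraceD, raddfN) /=.
rewrite !mxtraceZ mulmxA (sym Y D).
by field.
Qed.

Lemma dom_support_coneK X V : (0 < m)%N -> setD_AB A B !=set0 ->
  effdom (support_fun (setD_AB A B)) (X, V) -> coneK A V.
Proof.
move=> m_gt0 D0 [Vs V_fin]; split=> // u; rewrite /kerset /= => Au0.
have fin := support_fun_fin_num D0 V_fin.
case: D0 => _ [Y AY _].
(* The direction [u *m e] has [u] as first column and zeros elsewhere, so its curvature is the
   quadratic form of [V] at [u]. A first column exists because [m] is positive. *)
pose e : 'rV[R]_m := delta_mx 0 (Ordinal m_gt0).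
have -> : (u^T *m V *m u) ord0 ord0 = 2 * (2^-1 * \tr ((u *m e)^T *m V *m (u *m e))).
  rewrite mulrA divff ?pnatr_eq0 // mul1r trmx_mul !mulmxA mxtrace_mulC.
  rewrite !mulmxA /e trmx_delta mul_delta_mx -!mulmxA.
  have -> : delta_mx 0 0 = 1%:M :> 'M[R]_1.
    by apply/matrixP => i j; rewrite !ord1 !mxE.
  by rewrite mul1mx trace_mx11.
apply: mulr_ge0 => //.
apply: (@quadratic_bounded_curvature _
  (\tr ((u *m e)^T *m (X - V *m Y))) _ (space_inner (graph_pt Y) (X, V))
  (fine (support_fun (setD_AB A B) (X, V)))) => t.
rewrite -space_inner_graph_ptD // -lee_fin fineK //; apply/le_support_fun/setD_AB_graph_pt.
by rewrite mulmxDr AY -scalemxAr mulmxA Au0 mul0mx scaler0 addr0.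
Qed.

Lemma support_fun_critical X V Y Z : coneK A V -> A *m Y = B ->
  X = V *m Y + A^T *m Z ->
  support_fun (setD_AB A B) (X, V) = (space_inner (graph_pt Y) (X, V))%:E.
Proof.
move=> KV AY eX; apply/le_anti; rewrite le_support_fun ?andbT; last exact: setD_AB_graph_pt.
apply/support_fun_leP => _ [Y' AY' <-]; rewrite lee_fin -/(graph_pt Y').
have AD0 : A *m (Y' - Y) = 0 by rewrite mulmxBr AY AY' subrr.
have := coneK_trace_ge0 KV AD0.
(* Any competitor is [Y] moved along a kernel direction: the slope vanishes because [A] kills that
   direction, and the curvature term only lowers the value. *)
have -> : graph_pt Y' = graph_pt (Y + 1 *: (Y' - Y)) by rewrite scale1r addrC subrK.
rewrite space_inner_graph_ptD; last by case: KV.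
have -> : X - V *m Y = A^T *m Z by rewrite eX addrC addKr.
by rewrite mulmxA -trmx_mul AD0 trmx0 mul0mx mxtrace0; lra.
Qed.

Lemma support_fun_maximizer X V Y : symmx R n V -> A *m Y = B ->
  support_fun (setD_AB A B) (X, V) = (space_inner (graph_pt Y) (X, V))%:E ->
  exists Z : 'M[R]_(p, m), X = V *m Y + A^T *m Z.
Proof.
move=> Vs AY sE.
have [D AD0|Z XE] := @kernel_orthogonal_factor _ _ _ _ A (X - V *m Y); last first.
  by exists Z; rewrite -XE addrC subrK.
apply: (@quadratic_domination_slope0 _ _ (2^-1 * \tr (D^T *m V *m D))) => t.
have : ((space_inner (graph_pt (Y + t *: D)%R) (X, V))%:E <=
        support_fun (setD_AB A B) (X, V))%E.
  by apply/le_support_fun/setD_AB_graph_pt; rewrite mulmxDr -scalemxAr AD0 scaler0 addr0.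
by rewrite sE lee_fin space_inner_graph_ptD //; lra.
Qed.

Lemma support_fun_dominates_OmegaP P : (0 < m)%N -> setD_AB A B !=set0 ->
  ambient R n m P ->
  (forall x, ambient R n m x ->
     ((space_inner P x)%:E <= support_fun (setD_AB A B) x)%E) <-> Omega A B P.
Proof.
case: P => Y W m_gt0 D0 Ws; split=> [dom|[_ [/= AY [_ polW]]] [X V] Vs]; last first.
  have [V_fin|] := boolP (support_fun (setD_AB A B) (X, V) < +oo)%E; last first.
    by rewrite -leNgt leye_eq => /eqP ->; rewrite leey.
  have KV : coneK A V by exact: (dom_support_coneK (X := X) m_gt0 D0 (conj Vs V_fin)).
  apply: le_trans (le_support_fun (X, V) (setD_AB_graph_pt AY)).
  rewrite lee_fin space_inner_graph_ptE gerDl /sym_inner mxtrace_mulC; exact: polW.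
(* At [(A^T *m C', 0)] every point of [setD_AB A B] has the same pairing [\tr (C'^T *m B)]. Taking
   both [C] and [- C] turns the resulting inequality into an equality. *)
have AY : A *m Y = B.
  apply/eqP; rewrite -subr_eq0; apply/eqP; apply: trace_form_eq0 => C.
  suff ge0 C' : \tr (C'^T *m (A *m Y - B)) <= 0.
    apply/le_anti; rewrite ge0 /=.
    by have := ge0 (- C); rewrite raddfN /= mulNmx raddfN /= oppr_le0.
  have C0_amb : ambient R n m (A^T *m C', 0) by rewrite /ambient /symmx /= trmx0.
  have : ((space_inner (Y, W) (A^T *m C', 0%R))%:E <= (\tr (C'^T *m B)%R)%:E)%E.
    apply: le_trans (dom _ C0_amb) _; apply/support_fun_leP => _ [Y' AY' <-].
    rewrite lee_fin /space_inner /sym_inner /= mulmx0 mxtrace0 addr0.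
    by rewrite -mxtrace_tr !trmx_mul !trmxK -mulmxA AY'.
  rewrite lee_fin /space_inner /sym_inner /= mulmx0 mxtrace0 addr0.
  rewrite -mxtrace_tr !trmx_mul !trmxK -mulmxA mulmxBr raddfB /=.
  by rewrite subr_le0.
split=> //; split=> //=; split.
  by rewrite /symmx /= raddfD /= linearZ /= trmx_mul trmxK Ws.
move=> V KV; have Vs : symmx R n V by case: KV.
(* At this point [Y] is critical with multiplier [Z = 0], so the support value is the pairing with
   [graph_pt Y] and only the polarity inequality remains. *)
have := dom (V *m Y, V) Vs.
rewrite (@support_fun_critical _ _ Y 0) ?mulmx0 ?addr0 //.
by rewrite lee_fin space_inner_graph_ptE gerDl /sym_inner mxtrace_mulC.
Qed.

End SupportD.

(* The formula fails for m = 0 (sigma is then identically 0), so the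
   implicit positivity of m is explicit; n and p may be 0. *)
Theorem corollary3p2 (R : realType) (p n m : nat) (m_gt0 : (0 < m)%N)
    (A : 'M[R]_(p, n)) (B : 'M[R]_(p, m)) (rgeBA : rgeset B `<=` rgeset A)
    (X : 'M[R]_(n, m)) (V : 'M[R]_n)
    (domXV : effdom (support_fun (setD_AB A B)) (X, V)) :
  subdiff (support_fun (setD_AB A B)) (X, V) =
  [set P | Omega A B P /\
    (exists Z : 'M[R]_(p, m), X = V *m P.1 + A^T *m Z) /\
    sym_inner V (2^-1 *: (P.1 *m P.1^T) + P.2) = 0].
Proof.
have D0 : setD_AB A B !=set0.
  by have [Y AY] := rgeset_sub_factor rgeBA; exists (graph_pt Y); exact: setD_AB_graph_pt.
have KV := dom_support_coneK m_gt0 D0 domXV.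
apply/seteqP; split=> [[Y W] /(subdiff_support_fun _ D0 domXV)[Ws dom sE]|].
  have OmYW : Omega A B (Y, W) by exact/(support_fun_dominates_OmegaP m_gt0 D0 Ws).
  have [_ [/= AY [_ polW]]] := OmYW.
  (* Polarity gives one sign. The other holds because [graph_pt Y] cannot pair above the support
     value, which is the pairing of [(Y, W)]. *)
  have comp0 : sym_inner V (2^-1 *: (Y *m Y^T) + W) = 0.
    apply/le_anti/andP; split.
      by rewrite /sym_inner mxtrace_mulC; exact: polW.
    have := le_support_fun (X, V) (setD_AB_graph_pt AY).
    by rewrite sE lee_fin (space_inner_graph_ptE Y W) lerDl.
  split=> //; split=> //; apply: support_fun_maximizer AY _; first by case: KV.
  by rewrite sE space_inner_graph_ptE comp0 addr0.
move=> [Y W] /= [OmYW [[Z XE] comp0]].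
have [Ws [/= AY _]] := OmYW.
apply/(subdiff_support_fun _ D0 domXV); split=> //.
  exact/(support_fun_dominates_OmegaP m_gt0 D0 Ws).
by rewrite (support_fun_critical KV AY XE) space_inner_graph_ptE comp0 addr0.
Qed.
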